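(* Let $A=(a_{ij})_{i,j\in Z}$ be a row intensity matrix with finite nonempty index set $Z$, and let $P:=\lim_{t\to\infty}\exp(tA)$ be the final limit of its transition matrix. Let $\mathfrak{C}$ be the set of recurrence classes with respect to $A$, let $T\subseteq Z$ be the set of transient indices with respect to $A$, and let $R:=Z\setminus T$. Then: (1) For every recurrence class $J\in\mathfrak{C}$ and every $i\in J$, the row of $P$ of index $i$ equals $p_J$. (2) If $T\neq\emptyset$, then $P_T=O$ and $A_{T,R}P_R+A_TP_{T,R}=O$. Moreover $A_T$ is invertible, whence $$P_{T,R}=-A_T^{-1}A_{T,R}P_R .$$ (3) If $T\neq\emptyset$, define for each $J\in\mathfrak{C}$ the column vector $$(f_{i,J})_{i\in T}:=-A_T^{-1}\sum_{j\in J}(a_{ij})_{i\in T}.$$ Then for every $i\in T$ the row of $P$ of index $i$ equals $$\sum_{J\in\mathfrak{C}}f_{i,J}\,p_J .$$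
   Context: A row intensity matrix is a real square matrix $A=(a_{ij})_{i,j\in Z}$, indexed by a finite nonempty set $Z$, with $a_{ij}\ge 0$ for all $i\ne j$ and $\sum_{j\in Z}a_{ij}=0$ for all $i\in Z$. Its transition matrix is the function $t\mapsto\exp(tA)$, and the final limit is $\lim_{t\to\infty}\exp(tA)$; this limit exists for every row intensity matrix. Notation: for nonempty $I,J\subseteq Z$ and a matrix $M=(m_{ij})_{i,j\in Z}$, $M_{I,J}:=(m_{ij})_{i\in I,j\in J}$ and $M_J:=M_{J,J}$. $O$ denotes a zero matrix. A square matrix $(b_{ij})_{i,j\in J}$ is reducible if there is a nonempty proper subset $I$ of $J$ with $b_{ij}=0$ for all $i\in I$ and all $j\in J\setminus I$; otherwise it is irreducible (in particular every $1\times1$ matrix is irreducible). A recurrence class with respect to $A$ is a nonempty subset $J\subseteq Z$ such that $A_J$ is irreducible and $a_{ij}=0$ for all $i\in J$ and $j\in Z\setminus J$. An index is recurrent if it lies in some recurrence class, and transient otherwise. For a recurrence class $J$, $p_J=(p_j)_{j\in Z}$ denotes the unique row vector with $p_JA=0$, $p_j>0$ for $j\in J$, $p_j=0$ for $j\in Z\setminus J$, and $\sum_{j\in Z}p_j=1$. *)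

(* Defs.v *)
(* MathComp world, with MathComp-Analysis over an abstract realType. *)
From mathcomp Require Import all_boot all_order all_algebra.
From mathcomp Require Import all_classical all_reals all_analysis.
(* Imported again so that set0, setT, ... denote finite sets. *)
From mathcomp Require Import finset.

Set Implicit Arguments.
Unset Strict Implicit.
Unset Printing Implicit Defensive.

Import Order.TTheory GRing.Theory Num.Theory.
Import numFieldNormedType.Exports.

Local Open Scope ring_scope.

(* The finite nonempty index set Z is 'I_n.+1. *)
Definition row_intensity (R : realType) (n : nat) (A : 'M[R]_n.+1) : Prop :=
  (forall i j, i != j -> 0 <= A i j) /\ (forall i, \sum_j A i j = 0).

Definition expmx (R : realType) (n : nat) (A : 'M[R]_n.+1) : 'M[R]_n.+1 :=
  (lim (series (fun k : nat => (k`!%:R)^-1 *: A ^+ k) @ \oo))%classic.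

Definition transition_mx (R : realType) (n : nat) (A : 'M[R]_n.+1) (t : R) :
    'M[R]_n.+1 :=
  expmx (t *: A).

Definition final_limit (R : realType) (n : nat) (A : 'M[R]_n.+1) :
    'M[R]_n.+1 :=
  (lim (transition_mx A t @[t --> +oo%R]))%classic.

(* M_{I,J}: its rows (resp. columns) are numbered by 'I_#|I| (resp. 'I_#|J|),
   the k-th one being that of index enum_val k. *)
Definition submatrix (R : realType) (n : nat) (M : 'M[R]_n) (I J : {set 'I_n}) :
    'M[R]_(#|I|, #|J|) :=
  mxsub (fun k : 'I_#|I| => enum_val k) (fun l : 'I_#|J| => enum_val l) M.

Definition reducible (R : realType) (m : nat) (B : 'M[R]_m) : bool :=
  [exists I : {set 'I_m}, [&& I != set0, I \proper setT
    & [forall i in I, forall j in ~: I, B i j == 0]]].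

Definition irreducible (R : realType) (m : nat) (B : 'M[R]_m) : bool :=
  ~~ reducible B.

Definition recurrence_class (R : realType) (n : nat) (A : 'M[R]_n)
    (J : {set 'I_n}) : bool :=
  [&& J != set0, irreducible (submatrix A J J)
    & [forall i in J, forall j in ~: J, A i j == 0]].

Definition recurrence_classes (R : realType) (n : nat) (A : 'M[R]_n) :
    {set {set 'I_n}} :=
  [set J | recurrence_class A J].

Definition transient (R : realType) (n : nat) (A : 'M[R]_n) : {set 'I_n} :=
  [set i | ~~ [exists J in recurrence_classes A, i \in J]].

Definition is_stationary_row (R : realType) (n : nat) (A : 'M[R]_n)
    (J : {set 'I_n}) (p : 'rV[R]_n) : Prop :=
  [/\ p *m A = 0,
      forall j, j \in J -> 0 < p 0 j,
      forall j, j \notin J -> p 0 j = 0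
    & \sum_j p 0 j = 1].

(* The row vector p_J, by description: for a recurrence class J of a row
   intensity matrix A exactly one p satisfies is_stationary_row A J p (the
   default value 0 never does). *)
Definition stationary_row (R : realType) (n : nat) (A : 'M[R]_n)
    (J : {set 'I_n}) : 'rV[R]_n :=
  xget 0 (is_stationary_row A J : classical_sets.set 'rV[R]_n).

(* Main.v *)
Require Import Defs.
From mathcomp Require Import all_boot all_order all_algebra.
From mathcomp Require Import all_classical all_reals all_analysis.
From mathcomp Require Import finset.
From mathcomp Require Import ring lra.

Set Implicit Arguments.
Unset Strict Implicit.
Unset Printing Implicit Defensive.

Import Order.TTheory GRing.Theory Num.Theory.
Import numFieldNormedType.Exports.

Local Open Scope ring_scope.

(** The row vectors p_J and the coefficients f_{i,J} come out of linear algebra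
    once three facts about the final limit P are known: it exists, AP = PA = 0,
    and PY = Y whenever AY = 0.

    Existence rests on the decay of A exp(tA).  Write A = c(S - 1) with S
    stochastic (uniformization), so that exp(tA) = e^{-ct} exp(ctS).  In
    (S - 1) exp(sS) the coefficient of S^k is s^{k-1}/(k-1)! - s^k/k!, that is
    (s^k/k!)(k/s - 1), and the entries of S^k lie in [0, 1]; hence each entry of
    e^{-s}(S - 1) exp(sS) has modulus at most E|N - s|/s for a Poisson variable N
    of mean s, and so at most 1/sqrt s because N has variance s
    (norm_transition_mx_stochastic).  Therefore A exp(tA) tends to 0
    (cvg_mul_transition_mx).

    A row vector u = xA with uA = 0 satisfies u = u exp(tA) = x A exp(tA), which
    tends to 0, so u = 0: the left kernel and the row space of A are
    complementary, and 1 = K + DA with KA = 0 (left_kernel_row_space_split).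
    Hence exp(tA) = K + D A exp(tA) converges to K (cvg_final_limit).  The other
    properties of P pass to the limit.

    Each row of P is thus a nonnegative vector p with pA = 0 and sum 1.  The
    support of such a vector is closed, and no flow enters a closed set from
    elsewhere in the support; by minimality arguments p vanishes on transient
    indices (stationary_transient0) and is positive on a recurrence class that
    carries it (stationary_class_pos), which gives uniqueness of p_J and
    identifies the recurrent rows of P.  If A_T x = 0, extending x by 0 gives y with Ay = 0, so y = Py = 0,
    because the transient columns of P vanish; thus A_T is invertible.  The
    rows of AP = 0 with index in T now determine the rows of P with index in T
    from the recurrent ones; grouping the recurrent indices by class turns the
    solution into the combination of the p_J. *)

(** * The matrix exponential as an entrywise power series *)

Lemma cvg_mx_entry (R : realType) (T : Type) (F : set_system T) m n
    (f : T -> 'M[R]_(m, n)) (L : 'M[R]_(m, n)) : Filter F ->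
  (forall i j, (f x i j @[x --> F] --> L i j)%classic) ->
  (f x @[x --> F] --> L)%classic.
Proof.
move=> FF fL; apply/cvgrPdist_le => /= e e0; near=> x.
rewrite [leLHS]/Num.Def.normr/= mx_normrE (bigmax_le _ (ltW e0))//= => i _.
rewrite !mxE/=.
move: i; near: x; apply: filter_forall => /= i.
exact: ((cvgrPdist_le _ _).1 (fL i.1 i.2)).
Unshelve. all: by end_near. Qed.

Lemma cvg_entry (R : realType) (T : Type) (F : set_system T) m n
    (f : T -> 'M[R]_(m, n)) (L : 'M[R]_(m, n)) i j : Filter F ->
  (f x @[x --> F] --> L)%classic ->
  (f x i j @[x --> F] --> L i j)%classic.
Proof.
move=> FF fL.
exact: (@cvg_comp _ _ _ f (fun M : 'M[R]_(m, n) => M i j) F _ _ fL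
  (@coord_continuous R m n i j L)).
Qed.

Lemma cvg_mulmxl (R : realType) (T : Type) (F : set_system T) m n p
    (B : 'M[R]_(m, n)) (f : T -> 'M[R]_(n, p)) (L : 'M[R]_(n, p)) : Filter F ->
  (f x @[x --> F] --> L)%classic ->
  (B *m f x @[x --> F] --> B *m L)%classic.
Proof.
move=> FF fL; apply: cvg_mx_entry => i j.
under eq_fun do rewrite mxE; rewrite mxE.
apply: cvg_big => [|k _]; first exact: add_continuous.
by apply: cvgM; [exact: cvg_cst|exact: cvg_entry].
Qed.

Lemma cvg_mulmxr (R : realType) (T : Type) (F : set_system T) m n p
    (B : 'M[R]_(n, p)) (f : T -> 'M[R]_(m, n)) (L : 'M[R]_(m, n)) : Filter F ->
  (f x @[x --> F] --> L)%classic ->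
  (f x *m B @[x --> F] --> L *m B)%classic.
Proof.
move=> FF fL; apply: cvg_mx_entry => i j.
under eq_fun do rewrite mxE; rewrite mxE.
apply: cvg_big => [|k _]; first exact: add_continuous.
by apply: cvgM; [exact: cvg_entry|exact: cvg_cst].
Qed.

(** Entrywise, t |-> exp(tB) is the power series with these coefficients, which
    makes the theory of real power series available. *)
Definition exp_entry_coeff (R : realType) n (B : 'M[R]_n.+1) i j (k : nat) : R :=
  (k`!%:R)^-1 * (B ^+ k) i j.

Lemma exp_partial_sum_entry (R : realType) n (B : 'M[R]_n.+1) (t : R) i j m :
  series (fun k : nat => (k`!%:R)^-1 *: (t *: B) ^+ k) m i j
  = pseries (exp_entry_coeff B i j) t m.
Proof.
rewrite /pseries /series /= summxE; apply: eq_bigr => k _.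
by rewrite exprZn !mxE /exp_entry_coeff -mulrA (mulrC (t ^+ k)).
Qed.

Lemma normr_exprmx_le (R : realType) n (B : 'M[R]_n.+1) (M : R) i j k :
  (forall i, \sum_j `|B i j| <= M) -> `|(B ^+ k) i j| <= M ^+ k.
Proof.
move=> BM; have M0 : 0 <= M by apply: le_trans (BM i); apply: sumr_ge0.
elim: k i j => [|k IH] i j.
  by rewrite !expr0 !mxE; case: (i == j); rewrite ?normr1 ?normr0.
rewrite !exprS mxE (le_trans (ler_norm_sum _ _ _))//.
rewrite (@le_trans _ _ (\sum_l `|B i l| * M ^+ k))//.
  by apply: ler_sum => l _; rewrite normrM ler_wpM2l.
by rewrite -mulr_suml ler_wpM2r// exprn_ge0.
Qed.

(** Each entry of the series of exp(tB) is dominated by the series of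
    exp(M |t|), M the sum of the moduli of the entries of B. *)
Lemma cvg_pseries_exp_entry (R : realType) n (B : 'M[R]_n.+1) i j t :
  cvgn (pseries (exp_entry_coeff B i j) t).
Proof.
pose M := (\sum_i \sum_j `|B i j|)%R.
have BM k : \sum_l `|B k l| <= M.
  by rewrite /M [leRHS](bigD1 k)//= lerDl; apply: sumr_ge0 => ? _; exact: sumr_ge0.
apply: normed_cvg; apply: series_le_cvg (is_cvg_series_exp_coeff (M * `|t|)).
- by move=> k /=.
- move=> k /=; apply: exp_coeff_ge0; rewrite mulr_ge0//.
  by apply: sumr_ge0 => ? _; exact: sumr_ge0.
- move=> k; rewrite /exp_coeff /= /exp_entry_coeff !normrM exprMn.
  rewrite [`|_^-1|]ger0_norm ?invr_ge0// -mulrA mulrCA -[leRHS]mulrA.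
  apply: ler_pM => //.
    exact: normr_exprmx_le.
  by rewrite mulrC normrX.
Qed.

Lemma cvg_expmx (R : realType) n (B : 'M[R]_n.+1) :
  (series (fun k : nat => (k`!%:R)^-1 *: B ^+ k) @ \oo --> expmx B)%classic.
Proof.
suff h : (series (fun k : nat => (k`!%:R)^-1 *: B ^+ k) @ \oo -->
  (\matrix_(i, j) limn (pseries (exp_entry_coeff B i j) 1)))%classic.
  by rewrite /expmx; exact: (cvgP _ h).
apply: cvg_mx_entry => i j; rewrite mxE.
have E m := exp_partial_sum_entry B 1 i j m; rewrite scale1r in E.
under eq_fun do rewrite E.
exact: cvg_pseries_exp_entry.
Qed.

Lemma cvg_transition_mx_entry (R : realType) n (B : 'M[R]_n.+1) t i j :
  (pseries (exp_entry_coeff B i j) t @ \oo --> transition_mx B t i j)%classic.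
Proof.
have -> : pseries (exp_entry_coeff B i j) t =
    (fun m => series (fun k : nat => (k`!%:R)^-1 *: (t *: B) ^+ k) m i j).
  by apply/funext => m; rewrite exp_partial_sum_entry.
exact: cvg_entry (@cvg_expmx R n (t *: B)).
Qed.

Lemma transition_mx_entryE (R : realType) n (B : 'M[R]_n.+1) i j :
  (fun t => transition_mx B t i j) =
  (fun t => limn (pseries (exp_entry_coeff B i j) t)).
Proof.
apply/funext => t; apply/esym/cvg_lim => //.
exact: cvg_transition_mx_entry.
Qed.

(** * The differential equation of the exponential *)

Lemma cvg_pseries_lincomb (R : realType) m (a : 'I_m -> R) (v : 'I_m -> nat -> R)
    (V : 'I_m -> R) (u : nat -> R) (t : R) :
  (forall k, u k = \sum_l a l * v l k) ->
  (forall l, (pseries (v l) t @ \oo --> V l)%classic) ->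
  (pseries u t @ \oo --> \sum_l a l * V l)%classic.
Proof.
move=> uE vV.
have -> : pseries u t = (fun N => \sum_l a l * pseries (v l) t N).
  apply/funext => N; rewrite /pseries /series /=.
  under [RHS]eq_bigr do rewrite mulr_sumr.
  rewrite exchange_big /=; apply: eq_bigr => k _.
  by rewrite uE mulr_suml; apply: eq_bigr => l _; rewrite mulrA.
apply: cvg_big => [|l _]; first exact: add_continuous.
by apply: cvgM; [exact: cvg_cst|exact: vV].
Qed.

(** Termwise differentiation is left multiplication by B: this is
    B^{k+1} = B B^k divided by k!. *)
Lemma pseries_diffs_exp_entry_coeff (R : realType) n (B : 'M[R]_n.+1) i j k :
  pseries_diffs (exp_entry_coeff B i j) k = \sum_l B i l * exp_entry_coeff B l j k.
Proof.
rewrite /pseries_diffs /exp_entry_coeff factS natrM invfM exprS mxE mulrA.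
rewrite mulVKf ?pnatr_eq0// mulr_sumr; apply: eq_bigr => l _.
by rewrite mulrCA.
Qed.

Lemma cvg_pseries_diffs_exp_entry (R : realType) n (B : 'M[R]_n.+1) i j t :
  (pseries (pseries_diffs (exp_entry_coeff B i j)) t @ \oo
     --> (B *m transition_mx B t) i j)%classic.
Proof.
rewrite mxE; apply: cvg_pseries_lincomb => [k|l].
  exact: pseries_diffs_exp_entry_coeff.
exact: cvg_transition_mx_entry.
Qed.

Lemma is_derive_transition_mx (R : realType) n (B : 'M[R]_n.+1) i j (t : R) :
  is_derive t 1 (fun t => transition_mx B t i j) ((B *m transition_mx B t) i j).
Proof.
rewrite transition_mx_entryE.
rewrite -(cvg_lim _ (@cvg_pseries_diffs_exp_entry R n B i j t))//.
apply: (@pseries_snd_diffs _ _ (`|t| + 1)).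
- exact: (cvgP _ (@cvg_transition_mx_entry R n B _ i j)).
- exact: (cvgP _ (@cvg_pseries_diffs_exp_entry R n B i j _)).
- apply: (cvgP (\sum_l B i l * (B *m transition_mx B (`|t| + 1)) l j)).
  pose v l := pseries_diffs (exp_entry_coeff B l j).
  apply: (cvg_pseries_lincomb (v := v)) => [k|l]; rewrite /v.
    rewrite /pseries_diffs -/(pseries_diffs _ _) pseries_diffs_exp_entry_coeff.
    by rewrite mulr_sumr; apply: eq_bigr => l _; rewrite mulrCA.
  exact: cvg_pseries_diffs_exp_entry.
- by rewrite [ltRHS]ger0_norm// ltrDl.
Qed.

Lemma transition_mx0 (R : realType) n (B : 'M[R]_n.+1) : transition_mx B 0 = 1.
Proof.
apply: (norm_cvg_unique (@cvg_expmx R n (0 *: B))).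
apply: cvg_near_cst; near=> m.
have m0 : (0 < m)%N by near: m; exists 1%N.
rewrite /series/= -(prednK m0) big_nat_recl//= big1_seq ?addr0.
  by rewrite expr0 fact0 invr1 scale1r.
by move=> k _; rewrite scale0r exprS mul0r scaler0.
Unshelve. all: by end_near. Qed.

Lemma transition_mx_comm (R : realType) n (B : 'M[R]_n.+1) t :
  transition_mx B t *m B = B *m transition_mx B t.
Proof.
have h := @cvg_expmx R n (t *: B).
pose S m := series (fun k : nat => (k`!%:R)^-1 *: (t *: B) ^+ k) m : 'M[R]_n.+1.
have hr : (S m *m B @[m --> \oo] --> transition_mx B t *m B)%classic.
  exact: cvg_mulmxr h.
have hl : (B *m S m @[m --> \oo] --> B *m transition_mx B t)%classic.
  exact: cvg_mulmxl h.
suff SB : (fun m => B *m S m) = (fun m => S m *m B).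
  by rewrite SB in hl; exact: (norm_cvg_unique hr hl).
apply/funext => m; rewrite /S /series/= mulmx_suml mulmx_sumr.
apply: eq_bigr => k _.
rewrite -scalemxAl -scalemxAr exprZn -scalemxAl -scalemxAr.
by congr (_ *: (_ *: _)); rewrite -[LHS]exprS exprSr.
Qed.

(** If Y' = BY then exp(-tB) Y(t) has derivative 0, since exp(-tB) commutes
    with B. *)
Lemma transition_mxN_solution (R : realType) n (B : 'M[R]_n.+1) (Y : R -> 'M[R]_n.+1) t :
  (forall (t : R) i j, is_derive t (1 : R) (fun s : R => Y s i j) ((B *m Y t) i j)) ->
  transition_mx (- B) t *m Y t = Y 0.
Proof.
move=> Y'.
suff /(_ 0) -> : forall s, transition_mx (- B) t *m Y t = transition_mx (- B) s *m Y s.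
  by rewrite transition_mx0 mul1mx.
move=> s; apply/matrixP => i j.
apply: (@is_derive_0_is_cst R (fun u => (transition_mx (- B) u *m Y u) i j)) => u.
have -> : (fun u => (transition_mx (- B) u *m Y u) i j) =
   \sum_l ((fun u => transition_mx (- B) u i l) * (fun u => Y u l j)).
  by apply/funext => v; rewrite mxE fct_sumE.
pose E := transition_mx (- B) u.
have -> : 0 = \sum_l (E i l *: (B *m Y u) l j + Y u l j *: (- B *m E) i l).
  rewrite big_split/=.
  transitivity ((E *m (B *m Y u) + (- B *m E) *m Y u) i j).
    rewrite /E -[in (- B *m _)]transition_mx_comm mulmxN mulNmx mulmxA subrr.
    by rewrite mxE.
  rewrite mxE [X in X + _]mxE [X in _ + X]mxE; congr (_ + _).
  by apply: eq_bigr => l _; rewrite mulrC.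
apply: is_derive_sum => l.
apply: is_deriveM.
exact: is_derive_transition_mx.
Qed.

(** Y(t) and exp(tB) are both right inverses of the square matrix exp(-tB). *)
Lemma transition_mx_unique (R : realType) n (B : 'M[R]_n.+1) (Y : R -> 'M[R]_n.+1) t :
  Y 0 = 1 ->
  (forall (t : R) i j, is_derive t (1 : R) (fun s : R => Y s i j) ((B *m Y t) i j)) ->
  Y t = transition_mx B t.
Proof.
move=> Y0 Y'.
have EY := transition_mxN_solution t Y'; rewrite Y0 in EY.
have := transition_mxN_solution t (fun (t : R) i j => @is_derive_transition_mx R n B i j t).
rewrite transition_mx0 -EY => /esym.
by apply: (can_inj (mulKmx (proj1 (mulmx1_unit EY)))).
Qed.

(** Both sides solve Y' = (B - c)Y with Y(0) = 1. *)
Lemma transition_mx_shift (R : realType) n (B : 'M[R]_n.+1) (c t : R) :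
  transition_mx (B - c%:M) t = expR (- (c * t)) *: transition_mx B t.
Proof.
pose Y (t : R) := expR (- (c * t)) *: transition_mx B t.
symmetry; apply: (@transition_mx_unique _ _ _ Y) => [|s i j]; rewrite /Y.
  by rewrite mulr0 oppr0 expR0 scale1r transition_mx0.
have -> : (fun s => (expR (- (c * s)) *: transition_mx B s) i j) =
  (fun s => expR (- (c * s))) * (fun s => transition_mx B s i j).
  by apply/funext => u; rewrite mxE.
have dB := @is_derive_transition_mx R n B i j s.
apply: trigger_derive.
rewrite mulmxBl mul_scalar_mx -scalemxAr.
set X := B *m _; rewrite !mxE /GRing.scale/=.
by ring.
Qed.

(** * Decay of A exp(tA) by uniformization *)

Lemma series_exp_coeff_le (R : realType) (s : R) m :
  0 <= s -> series (exp_coeff s) m <= expR s.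
Proof.
move=> s0; apply: (nondecreasing_cvgn_le _ (is_cvg_series_exp_coeff s)).
by apply/nondecreasing_seqP => k; rewrite /series/= big_nat_recr//= lerDl;
  exact: (exp_coeff_ge0 k s0).
Qed.

Lemma exp_coeffS (R : realType) (s : R) k :
  k.+1%:R * exp_coeff s k.+1 = s * exp_coeff s k.
Proof.
rewrite /exp_coeff/= factS natrM invfM exprS.
rewrite mulrCA -!mulrA; congr (_ * _); congr (_ * _).
by rewrite mulVKf// pnatr_eq0.
Qed.

(** Truncation of the variance identity E(N - s)^2 = s for a Poisson variable
    N of mean s.  The boundary term is nonpositive as soon as m >= s, so that no
    limit is needed in order to bound the left-hand side. *)
Lemma exp_coeff_second_moment (R : realType) (s : R) m :
  \sum_(0 <= k < m) exp_coeff s k * (k%:R - s) ^+ 2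
  = s * series (exp_coeff s) m + m%:R * (s - m%:R) * exp_coeff s m.
Proof.
elim: m => [|m IH]; first by rewrite /series/= !big_geq// mulr0 !mul0r addr0.
rewrite big_nat_recr//= IH /series/= [in RHS]big_nat_recr//= -/(series _ _).
rewrite -/(series (exp_coeff s) m).
rewrite [_.+1%:R * _]mulrC -[_ * _ * exp_coeff s m.+1]mulrA exp_coeffS -natr1.
by ring.
Qed.

(** Bounds E|N - s|/s by 1/sqrt s for a Poisson variable N of mean s (up to the
    factor e^s), from the second moment and the inequality
    |d| <= (sqrt s + d^2/sqrt s)/2, which takes the place of Cauchy-Schwarz. *)
Lemma exp_coeff_abs_deviation (R : realType) (s : R) m : 0 < s -> s <= m%:R ->
  \sum_(0 <= k < m) exp_coeff s k * `|k%:R / s - 1| <= expR s / Num.sqrt s.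
Proof.
move=> s0 sm; set r := Num.sqrt s.
have r0 : 0 < r by rewrite sqrtr_gt0.
have rr : r * r = s by rewrite -expr2 sqr_sqrtr// ltW.
have e0 k : 0 <= exp_coeff s k by apply: exp_coeff_ge0; exact: ltW.
(* |d| <= (r + d^2 / r) / 2 with r = sqrt s, divided by s. *)
have amgm k : `|k%:R / s - 1| <= (1 + (k%:R - s) ^+ 2 / s) / (2 * r).
  have -> : k%:R / s - 1 = (k%:R - s) / s by field; rewrite gt_eqF.
  set d : R := _ - s; rewrite normrM [`|s^-1|]gtr0_norm ?invr_gt0//.
  rewrite -[d ^+ 2]real_normK ?num_real//.
  have : 0 <= (`|d| - r) ^+ 2 by rewrite sqr_ge0.
  move: `|d| => x h.
  rewrite ler_pdivrMr// -rr.
  have -> : (1 + x ^+ 2 / (r * r)) / (2 * r) * (r * r) = (r ^+ 2 + x ^+ 2) / (2 * r).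
    by field; rewrite gt_eqF.
  rewrite ler_pdivlMr ?mulr_gt0//; nra.
apply: (@le_trans _ _ (\sum_(0 <= k < m)
    exp_coeff s k * ((1 + (k%:R - s) ^+ 2 / s) / (2 * r)))).
  by apply: ler_sum => k _; rewrite ler_wpM2l.
have -> : \sum_(0 <= k < m)
    exp_coeff s k * ((1 + (k%:R - s) ^+ 2 / s) / (2 * r)) =
  (series (exp_coeff s) m + (\sum_(0 <= k < m) exp_coeff s k * (k%:R - s) ^+ 2) / s) / (2 * r).
  rewrite /series/= mulr_suml -big_split/= mulr_suml; apply: eq_bigr => k _.
  by rewrite mulrA mulrDr mulr1 mulrA.
rewrite exp_coeff_second_moment.
have := series_exp_coeff_le m (ltW s0); set E := series _ m => Em.
have h : (s * E + m%:R * (s - m%:R) * exp_coeff s m) / s <= E.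
  rewrite ler_pdivrMr// [E * s]mulrC gerDl mulr_le0_ge0// mulr_ge0_le0//.
  by rewrite subr_le0.
rewrite ler_pdivrMr ?mulr_gt0//.
have -> : expR s / r * (2 * r) = 2 * expR s by field; rewrite gt_eqF.
by lra.
Qed.

(** Summation by parts, with a_{k-1} = a_k k/s for a_k = s^k/k!. *)
Lemma exp_coeff_telescope (R : realType) (s : R) (x : nat -> R) m : 0 < s ->
  \sum_(0 <= k < m) exp_coeff s k * (x k.+1 - x k) =
  \sum_(0 <= k < m.+1) exp_coeff s k * (k%:R / s - 1) * x k + exp_coeff s m * x m.
Proof.
move=> s0; elim: m => [|m IH].
  by rewrite big_geq// big_nat1 mul0r; ring.
rewrite big_nat_recr//= IH [in RHS]big_nat_recr//=.
have -> : exp_coeff s m = m.+1%:R * exp_coeff s m.+1 / s.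
  by rewrite exp_coeffS mulrAC divff ?mul1r// gt_eqF.
by ring.
Qed.

Definition stochastic (R : realType) n (S : 'M[R]_n.+1) :=
  (forall i j, 0 <= S i j) /\ (forall i, \sum_j S i j = 1).

Lemma stochasticX (R : realType) n (S : 'M[R]_n.+1) k :
  stochastic S -> stochastic (S ^+ k).
Proof.
move=> [S0 S1]; elim: k => [|k [IH0 IH1]]; split=> i.
- by move=> j; rewrite expr0 mxE; case: (_ == _).
- under eq_bigr do rewrite expr0 mxE.
  by rewrite (bigD1 i)//= eqxx big1 ?addr0// => j; rewrite eq_sym => /negPf ->.
- by move=> j; rewrite exprS mxE; apply: sumr_ge0 => l _; exact: mulr_ge0.
- under eq_bigr do rewrite exprS mxE.
  rewrite exchange_big/= -[RHS](S1 i); apply: eq_bigr => l _.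
  by rewrite -mulr_sumr IH1 mulr1.
Qed.

Lemma stochastic_le1 (R : realType) n (S : 'M[R]_n.+1) i j :
  stochastic S -> S i j <= 1.
Proof.
by move=> [S0 S1]; rewrite -(S1 i) (bigD1 j)//= lerDl sumr_ge0.
Qed.

(** Any c > 0 with c >= -a_ii for all i makes 1 + A/c stochastic. *)
Lemma row_intensity_uniformization (R : realType) n (A : 'M[R]_n.+1) :
  row_intensity A ->
  exists2 c : R, 0 < c & exists2 S, stochastic S & A = c *: S - c%:M.
Proof.
move=> [A0 A1]; pose c := 1 + \sum_i `|A i i|.
have c0 : 0 < c by rewrite ltr_pwDl// sumr_ge0.
exists c => //; exists (c^-1 *: A + 1%:M); last first.
  by rewrite scalerDr scalerA divff ?gt_eqF// scale1r scale_scalar_mx mulr1 addrK.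
split=> i.
  move=> j; rewrite !mxE; have [<-|ij] := eqVneq i j; last first.
    by rewrite addr0 mulr_ge0 ?A0// invr_ge0 ltW.
  rewrite mulr1n -[1](mulVf (lt0r_neq0 c0)) -mulrDr.
  apply: mulr_ge0; first by rewrite invr_ge0 ltW.
  rewrite -lerBlDl sub0r (le_trans (ler_norm _))// normrN.
  by rewrite /c (bigD1 i)//= addrCA lerDl addr_ge0// sumr_ge0.
under eq_bigr do rewrite !mxE.
rewrite big_split/= -mulr_sumr A1 mulr0 add0r.
by rewrite (bigD1 i)//= eqxx big1 ?addr0// => j; rewrite eq_sym => /negPf ->.
Qed.

(** After summation by parts the powers of S appear with coefficients
    (s^k/k!)(k/s - 1), and their entries lie in [0, 1]. *)
Lemma norm_transition_mx_stochastic (R : realType) n (S : 'M[R]_n.+1) (s : R) i j :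
  0 < s -> stochastic S ->
  `|((S - 1%:M) *m transition_mx S s) i j| <= expR s / Num.sqrt s.
Proof.
move=> s0 stS.
have SX k : 0 <= (S ^+ k) i j <= 1.
  by rewrite (proj1 (stochasticX k stS)) stochastic_le1//; exact: stochasticX.
pose u m := \sum_(0 <= k < m) exp_coeff s k * ((S ^+ k.+1) i j - (S ^+ k) i j).
have uL : (u m @[m --> \oo] --> ((S - 1%:M) *m transition_mx S s) i j)%classic.
  have -> : ((S - 1%:M) *m transition_mx S s) i j =
     (S *m transition_mx S s) i j - transition_mx S s i j.
    by rewrite mulmxBl mul1mx; set X := S *m _; rewrite !mxE.
  have -> : u = (fun m => pseries (pseries_diffs (exp_entry_coeff S i j)) s m
                 - pseries (exp_entry_coeff S i j) s m).
    apply/funext => m; rewrite /u /pseries /series/= -sumrB; apply: eq_bigr => k _.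
    rewrite /pseries_diffs /exp_entry_coeff /exp_coeff/= factS natrM invfM mulrA.
    by rewrite mulVKf ?pnatr_eq0//; ring.
  by apply: cvgB; [exact: cvg_pseries_diffs_exp_entry|exact: cvg_transition_mx_entry].
have e0 k : 0 <= exp_coeff s k by apply: exp_coeff_ge0; exact: ltW.
have hL : (`|u m| - exp_coeff s m @[m --> \oo] -->
    `|((S - 1%:M) *m transition_mx S s) i j| - 0)%classic.
  by apply: cvgB; [exact: cvg_norm|exact: cvg_exp_coeff].
rewrite -[leLHS]subr0 -(cvg_lim _ hL)//.
apply: limr_le; first exact: (cvgP _ hL).
near=> m; rewrite lerBlDr /u exp_coeff_telescope//.
have sm : s <= m.+1%:R.
  by near: m; apply: (filterS _ (nbhs_infty_ger s)) => k /= /le_trans; apply; rewrite ler_nat.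
apply: le_trans (ler_normD _ _) _; apply: lerD; last first.
  case/andP: (SX m) => x0 x1; rewrite normrM (ger0_norm (e0 m)) (ger0_norm x0).
  exact: ler_piMr.
apply: le_trans (exp_coeff_abs_deviation s0 sm).
apply: le_trans (ler_norm_sum _ _ _) _; apply: ler_sum => k _.
case/andP: (SX k) => x0 x1.
rewrite normrM (ger0_norm x0) normrM (ger0_norm (e0 k)) ler_piMr//.
exact: mulr_ge0.
Unshelve. all: by end_near. Qed.

Lemma transition_mx_uniformization (R : realType) n (S : 'M[R]_n.+1) (c t : R) :
  transition_mx (c *: S - c%:M) t = expR (- (c * t)) *: transition_mx S (c * t).
Proof. by rewrite transition_mx_shift /transition_mx scalerA [t * c]mulrC. Qed.

Lemma transition_mx_ge0 (R : realType) n (A : 'M[R]_n.+1) (t : R) i j :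
  row_intensity A -> 0 <= t -> 0 <= transition_mx A t i j.
Proof.
move=> /row_intensity_uniformization[c c0 [S stS ->]] t0.
rewrite transition_mx_uniformization mxE mulr_ge0 ?expR_ge0//.
have h := @cvg_transition_mx_entry R n S (c * t) i j.
rewrite -(cvg_lim _ h)//; apply: limr_ge; first exact: (cvgP _ h).
near=> m; apply: sumr_ge0 => k _; rewrite /exp_entry_coeff !mulr_ge0 ?invr_ge0//.
  exact: (proj1 (stochasticX k stS)).
by rewrite exprn_ge0// mulr_ge0// ltW.
Unshelve. all: by end_near. Qed.

Lemma cvg_mul_transition_mx (R : realType) n (A : 'M[R]_n.+1) :
  row_intensity A ->
  (A *m transition_mx A t @[t --> +oo%R] --> (0 : 'M[R]_n.+1))%classic.
Proof.
move=> /row_intensity_uniformization[c c0 [S stS ->]].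
apply: cvg_mx_entry => i j; rewrite mxE.
apply/cvgr0Pnorm_le => e e0; near=> t.
have t0 : 0 < t by near: t; exact: nbhs_pinfty_gt.
have ct0 : 0 < c * t by rewrite mulr_gt0.
rewrite transition_mx_uniformization.
have -> : c *: S - c%:M = c *: (S - 1%:M).
  by rewrite scalerBr scale_scalar_mx mulr1.
have := norm_transition_mx_stochastic i j ct0 stS.
rewrite -scalemxAl -scalemxAr; move: (_ *m _) => X XB.
rewrite !mxE mulrA normrM ger0_norm ?mulr_ge0 ?expR_ge0 ?(ltW c0)//.
apply: (@le_trans _ _ (c * expR (- (c * t)) * (expR (c * t) / Num.sqrt (c * t)))).
  by rewrite ler_wpM2l// mulr_ge0 ?expR_ge0 ?(ltW c0).
rewrite -mulrA [expR (- _) * _]mulrA expRN mulVf ?gt_eqF ?expR_gt0// mul1r.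
(* The modulus is at most c / sqrt(ct), which is at most e once t >= c / e^2. *)
rewrite ler_pdivrMr ?sqrtr_gt0// mulrC -ler_pdivrMr//.
rewrite -(@ler_pXn2r _ 2)// ?nnegrE ?sqrtr_ge0 ?divr_ge0 ?(ltW c0) ?(ltW e0)//.
rewrite sqr_sqrtr ?(ltW ct0)//.
have -> : (c / e) ^+ 2 = c * (c / e ^+ 2) by field; rewrite gt_eqF.
rewrite ler_pM2l//.
Unshelve. all: by end_near. Qed.

(** * Existence and first properties of the final limit *)

Lemma transition_mx_mul_ker (R : realType) n p (B : 'M[R]_n.+1) (Y : 'M[R]_(n.+1, p)) t :
  B *m Y = 0 -> transition_mx B t *m Y = Y.
Proof.
move=> BY.
pose S m : 'M[R]_n.+1 := series (fun k : nat => (k`!%:R)^-1 *: (t *: B) ^+ k) m.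
have h : (S m *m Y @[m --> \oo] --> transition_mx B t *m Y)%classic.
  have hS := @cvg_expmx R n (t *: B); exact: cvg_mulmxr hS.
apply: (norm_cvg_unique h); apply: cvg_near_cst; near=> m.
have m0 : (0 < m)%N by near: m; exists 1%N.
rewrite /S /series/= -(prednK m0) big_nat_recl//= mulmxDl expr0 fact0 invr1 scale1r.
rewrite mul1mx mulmx_suml big1_seq ?addr0// => k _.
by rewrite exprSr -scalemxAl exprZn -mulmxE -scalemxAr -!scalemxAl -mulmxA BY mulmx0 !scaler0.
Unshelve. all: by end_near. Qed.

Lemma transition_mx_ker_mul (R : realType) n p (B : 'M[R]_n.+1) (Y : 'M[R]_(p, n.+1)) t :
  Y *m B = 0 -> Y *m transition_mx B t = Y.
Proof.
move=> YB.
pose S m : 'M[R]_n.+1 := series (fun k : nat => (k`!%:R)^-1 *: (t *: B) ^+ k) m.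
have h : (Y *m S m @[m --> \oo] --> Y *m transition_mx B t)%classic.
  have hS := @cvg_expmx R n (t *: B); exact: cvg_mulmxl hS.
apply: (norm_cvg_unique h); apply: cvg_near_cst; near=> m.
have m0 : (0 < m)%N by near: m; exists 1%N.
rewrite /S /series/= -(prednK m0) big_nat_recl//= mulmxDr expr0 fact0 invr1 scale1r.
rewrite mulmx1 mulmx_sumr big1_seq ?addr0// => k _.
by rewrite exprS -scalemxAr -mulmxE mulmxA -scalemxAr YB scaler0 mul0mx scaler0.
Unshelve. all: by end_near. Qed.

(** The left kernel and the row space of A meet trivially: u = xA with uA = 0
    is fixed by exp(tA), yet u exp(tA) = x A exp(tA) tends to 0.  By dimension
    they span the whole space. *)
Lemma left_kernel_row_space_split (R : realType) n (A : 'M[R]_n.+1) :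
  row_intensity A -> exists2 K : 'M[R]_n.+1, K *m A = 0 &
    exists D : 'M[R]_n.+1, 1%:M = K + D *m A.
Proof.
move=> hA.
have cap0 : (kermx A :&: A)%MS = 0.
  apply/eqP; rewrite -submx0; apply/rV_subP => u.
  rewrite sub_capmx submx0 => /andP[/sub_kermxP uA /submxP[x xA]].
  have h : (x *m (A *m transition_mx A t) @[t --> +oo%R] --> x *m (0 : 'M[R]_n.+1))%classic.
    exact: cvg_mulmxl (cvg_mul_transition_mx hA).
  have E : (fun t => x *m (A *m transition_mx A t)) = fun=> u.
    by apply/funext => t; rewrite mulmxA -xA transition_mx_ker_mul.
  rewrite E mulmx0 in h; apply/eqP; apply: (norm_cvg_unique _ h).
  exact: cvg_cst.
have full : (1%:M <= kermx A + A)%MS.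
  rewrite sub1mx /row_full eqn_leq rank_leq_col/=.
  by rewrite -[X in (_ <= X)%N]addn0 -(mxrank0 R n.+1 n.+1) -cap0
    mxrank_sum_cap mxrank_ker subnK ?rank_leq_row.
have /sub_addsmxP[[u v] /= E] := full.
by exists (u *m kermx A); [rewrite -mulmxA mulmx_ker mulmx0|exists v].
Qed.

(** With 1 = K + DA and KA = 0, exp(tA) = K + D A exp(tA) tends to K. *)
Lemma cvg_final_limit (R : realType) n (A : 'M[R]_n.+1) : row_intensity A ->
  (transition_mx A t @[t --> +oo%R] --> final_limit A)%classic.
Proof.
move=> hA; have [K KA [D E]] := left_kernel_row_space_split hA.
suff h : (transition_mx A t @[t --> +oo%R] --> K)%classic by exact: (cvgP _ h).
have -> : transition_mx A = (fun t => K + D *m (A *m transition_mx A t)).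
  apply/funext => t; rewrite -[LHS]mul1mx E mulmxDl mulmxA.
  by rewrite transition_mx_ker_mul.
rewrite -[X in (_ --> X)%classic]addr0 -[X in _ + X](mulmx0 _ D).
apply: cvgD; first exact: cvg_cst.
exact: cvg_mulmxl (cvg_mul_transition_mx hA).
Qed.

Section FinalLimit.
Variables (R : realType) (n : nat) (A : 'M[R]_n.+1).
Hypothesis hA : row_intensity A.

Let P := final_limit A.

Lemma mul_final_limit : A *m P = 0.
Proof.
have h : (A *m transition_mx A t @[t --> +oo%R] --> A *m P)%classic.
  exact: cvg_mulmxl (cvg_final_limit hA).
exact: (norm_cvg_unique h (cvg_mul_transition_mx hA)).
Qed.

Lemma final_limit_mul : P *m A = 0.
Proof.
have h : (transition_mx A t *m A @[t --> +oo%R] --> P *m A)%classic.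
  exact: cvg_mulmxr (cvg_final_limit hA).
have E : (fun t => transition_mx A t *m A) = (fun t => A *m transition_mx A t).
  by apply/funext => t; rewrite transition_mx_comm.
by rewrite E in h; exact: (norm_cvg_unique h (cvg_mul_transition_mx hA)).
Qed.

Lemma final_limit_mul_ker p (Y : 'M[R]_(n.+1, p)) : A *m Y = 0 -> P *m Y = Y.
Proof.
move=> AY.
have h : (transition_mx A t *m Y @[t --> +oo%R] --> P *m Y)%classic.
  exact: cvg_mulmxr (cvg_final_limit hA).
have E : (fun t => transition_mx A t *m Y) = (fun=> Y).
  by apply/funext => t; rewrite transition_mx_mul_ker.
by rewrite E in h; apply: (norm_cvg_unique h); exact: cvg_cst.
Qed.

Lemma final_limit_ge0 i j : 0 <= P i j.
Proof.
have h : (transition_mx A t i j @[t --> +oo%R] --> P i j)%classic.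
  exact: cvg_entry (cvg_final_limit hA).
rewrite -(cvg_lim _ h)//; apply: limr_ge; first exact: (cvgP _ h).
by near=> t; apply: transition_mx_ge0.
Unshelve. all: by end_near. Qed.

Lemma final_limit_row_sum i : \sum_j P i j = 1.
Proof.
have /matrixP/(_ i 0) : P *m const_mx 1 = const_mx 1 :> 'cV[R]_n.+1.
  apply: final_limit_mul_ker; apply/matrixP => k l; rewrite !mxE.
  by under eq_bigr do rewrite mxE mulr1; exact: (proj2 hA).
by rewrite !mxE => <-; apply: eq_bigr => k _; rewrite mxE mulr1.
Qed.

Lemma exprmx_closed_set (B : 'M[R]_n.+1) (J : {set 'I_n.+1}) k i j :
  (forall i j, i \in J -> j \notin J -> B i j = 0) ->
  i \in J -> j \notin J -> (B ^+ k) i j = 0.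
Proof.
move=> BJ; elim: k i => [|k IH] i iJ jJ.
  by rewrite expr0 mxE; case: eqVneq jJ => // <-; rewrite iJ.
rewrite exprS mxE big1// => l _; have [lJ|lJ] := boolP (l \in J).
  by rewrite IH// mulr0.
by rewrite BJ// mul0r.
Qed.

Lemma final_limit_closed_set (J : {set 'I_n.+1}) i j :
  (forall i j, i \in J -> j \notin J -> A i j = 0) ->
  i \in J -> j \notin J -> P i j = 0.
Proof.
move=> AJ iJ jJ.
have h : (transition_mx A t i j @[t --> +oo%R] --> P i j)%classic.
  exact: cvg_entry (cvg_final_limit hA).
have E : (fun t => transition_mx A t i j) = (fun=> 0).
  apply/funext => t; apply: (norm_cvg_unique (@cvg_transition_mx_entry R n A t i j)).
  apply: cvg_near_cst; near=> m.
  apply: big1 => k _; rewrite /exp_entry_coeff/=.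
  by rewrite (exprmx_closed_set _ AJ)// mulr0 mul0r.
by rewrite E in h; apply: (norm_cvg_unique h); exact: cvg_cst.
Unshelve. all: by end_near. Qed.

End FinalLimit.

(** * Recurrence classes and stationary vectors *)

Definition closed_set (R : realType) n (A : 'M[R]_n) (J : {set 'I_n}) : Prop :=
  forall i j, i \in J -> j \notin J -> A i j = 0.

(** Transfers irreducibility of A_J from subsets of the numbering type of J to
    subsets of J itself. *)
Lemma irreducible_submatrixP (R : realType) n (A : 'M[R]_n) (J : {set 'I_n}) :
  reflect (forall I : {set 'I_n}, I \subset J -> I != set0 ->
      (forall i j, i \in I -> j \in J -> j \notin I -> A i j = 0) -> I = J)
    (irreducible (submatrix A J J)).
Proof.
apply: (iffP negP) => [irr I IJ I0 AI|irr].
  apply/eqP; apply: contra_notT irr => IneJ.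
  have [i0 i0I] := set0Pn _ I0.
  have JI : exists2 j, j \in J & j \notin I.
    by apply/subsetPn; apply: contra IneJ => JI; rewrite eqEsubset IJ.
  have [j0 j0J j0I] := JI.
  have i0J := fintype.subsetP IJ _ i0I.
  apply/existsP; exists [set k | enum_val k \in I]; apply/and3P; split.
  - by apply/set0Pn; exists (enum_rank_in i0J i0); rewrite inE enum_rankK_in.
  - apply/properP; split; first exact: subsetT.
    by exists (enum_rank_in j0J j0); rewrite ?inE ?enum_rankK_in.
  - apply/forallP => k; apply/implyP; rewrite inE => kI.
    apply/forallP => l; apply/implyP; rewrite !inE => lI.
    by rewrite mxE AI// enum_valP.
move=> /existsP[I /and3P[/set0Pn[k0 k0I] /properP[_ [l0 _ l0I]] /forallP AI]].
have EI : enum_val @: I = J.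
  apply: irr.
  - by apply/fintype.subsetP => _ /imsetP[k _ ->]; exact: enum_valP.
  - by apply/set0Pn; exists (enum_val k0); apply/imsetP; exists k0.
  - move=> _ j /imsetP[k kI ->] jJ jI.
    have /implyP/(_ kI)/forallP/(_ (enum_rank_in jJ j)) := AI k.
    rewrite !inE mxE enum_rankK_in// => /implyP h; apply/eqP/h.
    apply: contra jI => jI; apply/imsetP.
    by exists (enum_rank_in jJ j); rewrite ?enum_rankK_in.
have : enum_val l0 \in enum_val @: I by rewrite EI enum_valP.
by case/imsetP => k kI /enum_val_inj E; rewrite E kI in l0I.
Qed.

(** The recurrence classes are the minimal nonempty closed sets: inside a
    closed set J, a subset without transitions to the rest of J is closed. *)
Lemma recurrence_classesP (R : realType) n (A : 'M[R]_n) (J : {set 'I_n}) :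
  reflect [/\ J != set0, closed_set A J & forall I : {set 'I_n}, I \subset J ->
      I != set0 -> closed_set A I -> I = J]
    (J \in recurrence_classes A).
Proof.
have closedP : reflect (closed_set A J) [forall i in J, forall j in ~: J, A i j == 0].
  apply: (iffP forallP) => [h i j iJ jJ|h i].
    have /implyP/(_ iJ)/forallP/(_ j)/implyP := h i.
    by rewrite inE => /(_ jJ)/eqP.
  apply/implyP => iJ; apply/forallP => j; apply/implyP; rewrite inE => jJ.
  by rewrite h.
rewrite inE; apply: (iffP and3P) => [[J0 /irreducible_submatrixP irr /closedP cJ]|[J0 cJ irr]].
  by split=> // I IJ I0 cI; apply: irr => // i j iI _; exact: cI.
split=> //; last exact/closedP.
apply/irreducible_submatrixP => I IJ I0 AI; apply: irr => // i j iI jI.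
have [jJ|jJ] := boolP (j \in J); first exact: AI.
by rewrite cJ// (fintype.subsetP IJ).
Qed.

(** The intersection of two closed sets is closed, so by minimality two classes
    that meet are equal. *)
Lemma recurrence_classes_trivIset (R : realType) n (A : 'M[R]_n) :
  trivIset (recurrence_classes A).
Proof.
apply/trivIsetP => J K /recurrence_classesP[_ cJ mJ] /recurrence_classesP[_ cK mK].
apply: contraR => /pred0Pn[i /= /andP[iJ iK]].
have cJK : closed_set A (J :&: K).
  move=> k l; rewrite !inE negb_and => /andP[kJ kK] /orP[lJ|lK].
    by rewrite cJ.
  by rewrite cK.
have JK0 : J :&: K != set0 by apply/set0Pn; exists i; rewrite inE iJ.
by rewrite -(mJ _ (subsetIl J K) JK0 cJK) (mK _ (subsetIr J K) JK0 cJK).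
Qed.

Lemma cover_recurrence_classes (R : realType) n (A : 'M[R]_n) :
  cover (recurrence_classes A) = ~: transient A.
Proof.
apply/setP => i; rewrite !inE negbK; apply/bigcupP/existsP => [[J JC iJ]|[J /andP[JC iJ]]].
  by exists J; rewrite JC.
by exists J.
Qed.

Section NonnegStationary.
Variables (R : realType) (n : nat) (A : 'M[R]_n.+1).
Hypothesis hA : row_intensity A.
Variable p : 'rV[R]_n.+1.
Hypothesis p0 : forall i, 0 <= p 0 i.
Hypothesis pA : p *m A = 0.

(** In the equation (pA)_j = 0 with p_j = 0 every term p_i a_ij is
    nonnegative, hence zero. *)
Lemma stationary_support_closed : closed_set A [set i | 0 < p 0 i].
Proof.
move=> i j; rewrite !inE => pi; rewrite lt0r p0 andbT negbK => /eqP pj.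
have ij : i != j by apply: contraTneq pi => ->; rewrite pj ltxx.
have /matrixP/(_ 0 j) := pA; rewrite !mxE => /eqP.
rewrite psumr_eq0 => [/allP/(_ i (mem_index_enum _))|k _].
  by rewrite /= mulf_eq0 gt_eqF//= => /eqP.
have [->|kj] := eqVneq k j; first by rewrite pj mul0r.
by rewrite mulr_ge0// (proj1 hA).
Qed.

(** Balance of flow: summing (pA)_k over k in K, the rows with index in the
    closed set K contribute 0, so the nonnegative inflow from outside K is 0. *)
Lemma stationary_no_flow_into_closed (K : {set 'I_n.+1}) i k :
  closed_set A K -> 0 < p 0 i -> i \notin K -> k \in K -> A i k = 0.
Proof.
move=> cK pi iK kK.
have ge0 l m : l \notin K -> m \in K -> 0 <= A l m.
  by move=> lK mK; apply: (proj1 hA); apply: contraNneq lK => ->.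
have S0 : \sum_l p 0 l * \sum_(m in K) A l m = 0.
  transitivity (\sum_(m in K) (p *m A) 0 m); last by rewrite pA big1// => m _; rewrite mxE.
  under [RHS]eq_bigr do rewrite mxE.
  by rewrite exchange_big/=; apply: eq_bigr => l _; rewrite mulr_sumr.
have SK l : l \in K -> \sum_(m in K) A l m = 0.
  move=> lK; rewrite -[RHS](proj2 hA l) [RHS](bigID (mem K))/= [X in _ + X]big1 ?addr0//.
  by move=> m; exact: cK.
move/eqP: S0; rewrite psumr_eq0 => [/allP/(_ i (mem_index_enum _))|l _]; last first.
  have [lK|lK] := boolP (l \in K); first by rewrite SK// mulr0.
  by rewrite mulr_ge0// sumr_ge0// => m; exact: ge0.
rewrite /= mulf_eq0 gt_eqF//= psumr_eq0 => [|m]; last exact: ge0.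
by move=> /allP/(_ k (mem_index_enum _)); rewrite kK => /eqP.
Qed.

(** If p_j > 0, take a minimal closed set U that contains j and lies in the
    support of p.  Were I a smaller nonempty closed subset of U, it would miss j by
    minimality, and U minus I, which sends no flow into I, would be closed and
    contain j.  So U is a recurrence class and j is recurrent. *)
Lemma stationary_transient0 j : j \in transient A -> p 0 j = 0.
Proof.
rewrite inE => jT; apply/eqP; apply: contraR jT => pj0.
have pj : 0 < p 0 j by rewrite lt0r pj0 p0.
(* A set minimal for cl is minimal among all closed sets containing j, and one
   exists below the support of p. *)
pose cl (U : {set 'I_n.+1}) := (j \in U) && `[< closed_set A U >].
have clI : cl [set i | 0 < p 0 i].
  by rewrite /cl inE pj; apply/asboolP; exact: stationary_support_closed.
have [U /minsetP[/andP[jU /asboolP cU] minU] UI] := minset_exists clI.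
apply/existsP; exists U; rewrite jU andbT; apply/recurrence_classesP; split => //.
  by apply/set0Pn; exists j.
move=> I IU /set0Pn[i0 i0I] cI.
have [jI|jI] := boolP (j \in I).
  by apply: minU => //; rewrite /cl jI; apply/asboolP.
have E : U :\: I = U.
  apply: minU; last exact: subsetDl.
  rewrite /cl inE jI jU; apply/asboolP => k l.
  rewrite !inE negb_and negbK => /andP[kI kU] /orP[lI|lU]; last exact: cU.
  apply: (stationary_no_flow_into_closed cI) => //.
  by have := fintype.subsetP UI _ kU; rewrite inE.
by have := fintype.subsetP IU _ i0I; rewrite -E inE i0I.
Qed.

(** The support of p is a closed subset of J, hence empty or equal to J. *)
Lemma stationary_class_pos (J : {set 'I_n.+1}) :
  J \in recurrence_classes A -> (forall j, j \notin J -> p 0 j = 0) ->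
  p != 0 -> forall j, j \in J -> 0 < p 0 j.
Proof.
move=> /recurrence_classesP[_ _ mJ] pJ pn0.
suff -> : J = [set i | 0 < p 0 i] by move=> j; rewrite inE.
apply/esym/mJ.
- by apply/fintype.subsetP => i; rewrite inE; apply: contraTT => /pJ ->; rewrite ltxx.
- apply: contra pn0 => /eqP I0; apply/eqP/rowP => i; rewrite mxE.
  apply/eqP; have := in_set0 i; rewrite -I0 inE lt0r p0 andbT => /negbT.
  by rewrite negbK.
- exact: stationary_support_closed.
Qed.

End NonnegStationary.

(** Subtract from p the largest multiple of q that keeps the difference
    nonnegative: the difference vanishes at some index of J, so it is 0 by
    stationary_class_pos, and the normalization makes the multiple 1. *)
Lemma stationary_row_unique (R : realType) n (A : 'M[R]_n.+1) J p q :
  row_intensity A -> J \in recurrence_classes A ->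
  is_stationary_row A J p -> is_stationary_row A J q -> p = q.
Proof.
move=> hA JC [pA pJ pN p1] [qA qJ qN q1].
have [/set0Pn[i0 i0J] _ _] := recurrence_classesP _ _ JC.
case: (@Order.TotalTheory.arg_minP _ R _ i0 (mem J)
  (fun j => p 0 j / q 0 j) i0J) => j0 j0J jmin.
set c := p 0 j0 / q 0 j0 in jmin.
pose r := p - c *: q.
have r0 i : 0 <= r 0 i.
  rewrite !mxE subr_ge0; have [iJ|iJ] := boolP (i \in J).
    by rewrite -ler_pdivlMr ?qJ// jmin.
  by rewrite pN// qN// mulr0.
have rA : r *m A = 0 by rewrite mulmxBl -scalemxAl pA qA scaler0 subr0.
have rN j : j \notin J -> r 0 j = 0 by move=> jJ; rewrite !mxE pN// qN// mulr0 subr0.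
have rE : r = 0.
  apply/eqP; apply: contraT => rn0.
  have := stationary_class_pos hA r0 rA JC rN rn0 j0J.
  by rewrite !mxE /c divfK ?subrr ?ltxx// gt_eqF// qJ.
have pE : p = c *: q by apply/eqP; rewrite -subr_eq0; apply/eqP.
have c1 : c = 1.
  by rewrite -p1 pE; under eq_bigr do rewrite mxE; rewrite -mulr_sumr q1 mulr1.
by rewrite pE c1 scale1r.
Qed.

(** * Rows of the final limit *)

Section FinalLimitRows.
Variables (R : realType) (n : nat) (A : 'M[R]_n.+1).
Hypothesis hA : row_intensity A.
Let P := final_limit A.

Lemma final_limit_row_ge0 i j : 0 <= row i P 0 j.
Proof. by rewrite mxE final_limit_ge0. Qed.

Lemma final_limit_row_mul i : row i P *m A = 0.
Proof. by rewrite -row_mul final_limit_mul// row0. Qed.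

Lemma final_limit_row_recurrent J i : J \in recurrence_classes A -> i \in J ->
  row i P = stationary_row A J.
Proof.
move=> JC iJ.
have rowP_stat : is_stationary_row A J (row i P).
  have [_ cJ _] := recurrence_classesP _ _ JC.
  have s1 : \sum_j row i P 0 j = 1.
    by under eq_bigr do rewrite mxE; exact: final_limit_row_sum.
  have rN j : j \notin J -> row i P 0 j = 0.
    by move=> jJ; rewrite mxE (final_limit_closed_set hA cJ).
  split=> //; first exact: final_limit_row_mul.
  apply: (stationary_class_pos hA (final_limit_row_ge0 i) (final_limit_row_mul i) JC rN).
  apply: contra_eq_neq s1 => ->; rewrite big1 ?(eq_sym 0) ?oner_eq0// => j _.
  by rewrite mxE.
apply/esym/xget_unique => // q qs.
exact: stationary_row_unique hA JC qs rowP_stat.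
Qed.

Lemma final_limit_transient_col i j : j \in transient A -> P i j = 0.
Proof.
move=> jT.
have := stationary_transient0 hA (final_limit_row_ge0 i) (final_limit_row_mul i) jT.
by rewrite mxE.
Qed.

Lemma recurrent_closed : closed_set A (~: transient A).
Proof.
move=> i j; rewrite -cover_recurrence_classes => /bigcupP[J JC iJ] jN.
have [_ cJ _] := recurrence_classesP _ _ JC.
by rewrite cJ//; apply: contra jN => jJ; apply/bigcupP; exists J.
Qed.

(** A vector killed by A_T extends by 0 to y with Ay = 0, recurrent indices
    having no transition to T.  Then y = Py = 0, the columns of P with index in T
    being 0. *)
Lemma submatrix_transient_unit :
  submatrix A (transient A) (transient A) \in unitmx.
Proof.
set T := transient A.
rewrite -unitmx_tr -row_free_unit -kermx_eq0; apply/rowV0P => v /sub_kermxP vM.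
(* v extended by 0 outside T: at most one k satisfies enum_val k = j. *)
pose y : 'cV[R]_n.+1 := \col_j \sum_k (v 0 k *+ (enum_val k == j :> 'I_n.+1)).
have yT k : y (enum_val k) 0 = v 0 k.
  rewrite mxE (bigD1 k)//= eqxx big1 ?addr0// => l lk.
  by rewrite (inj_eq enum_val_inj) (negPf lk).
have yN j : j \notin T -> y j 0 = 0.
  move=> jT; rewrite mxE big1// => k _; case: eqP => // kj.
  by move: jT; rewrite -kj enum_valP.
have Ay : A *m y = 0.
  apply/matrixP => i z; rewrite ord1 {z} !mxE (bigID (mem T))/=.
  rewrite [X in _ + X]big1 ?addr0; last first.
    by move=> j jT; rewrite yN// mulr0.
  have [iT|iT] := boolP (i \in T); last first.
    rewrite big1// => j jT; rewrite (recurrent_closed _ _) ?mul0r// inE ?iT//.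
    by rewrite negbK.
  rewrite big_enum_val/=.
  have /matrixP/(_ 0 (enum_rank_in iT i)) := vM; rewrite !mxE => vM0; apply: etrans vM0.
  by apply: eq_bigr => k _; rewrite yT !mxE enum_rankK_in// mulrC.
have y0 : y = 0.
  rewrite -(final_limit_mul_ker hA Ay); apply/matrixP => i z; rewrite ord1 {z} !mxE.
  rewrite big1// => j _; have [jT|jT] := boolP (j \in T).
    by rewrite -/P final_limit_transient_col// mul0r.
  by rewrite yN// mulr0.
by apply/rowP => k; rewrite -yT y0 !mxE.
Qed.

End FinalLimitRows.

Theorem theorem9 (R : realType) (n : nat) (A : 'M[R]_n.+1)
    (hA : row_intensity A) :
  let P := final_limit A in
  let C := recurrence_classes A in
  let T := transient A in
  let Rec := ~: T in
  [/\ (forall (J : {set 'I_n.+1}) (i : 'I_n.+1), J \in C -> i \in J ->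
         row i P = stationary_row A J),
      (T != set0 ->
         [/\ submatrix P T T = 0,
             submatrix A T Rec *m submatrix P Rec Rec
               + submatrix A T T *m submatrix P T Rec = 0,
             submatrix A T T \in unitmx
           & submatrix P T Rec
             = - invmx (submatrix A T T) *m submatrix A T Rec *m submatrix P Rec Rec])
    & (T != set0 ->
         let f (J : {set 'I_n.+1}) : 'cV[R]_#|T| :=
           - invmx (submatrix A T T)
             *m \sum_(j in J) \col_(k < #|T|) A (enum_val k) j in
         forall k : 'I_#|T|,
           row (enum_val k) P = \sum_(J in C) f J k 0 *: stationary_row A J)].
Proof.
move=> P C T Rec.
have unitT : submatrix A T T \in unitmx by exact: submatrix_transient_unit.
have AP i j : \sum_(l in Rec) A i l * P l j + \sum_(l in T) A i l * P l j = 0.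
  have /matrixP/(_ i j) := mul_final_limit hA; rewrite !mxE => AP.
  rewrite -[RHS]AP [RHS](bigID (mem T))/= addrC; congr (_ + _).
  by apply: eq_bigl => l; rewrite inE.
split; first exact: final_limit_row_recurrent.
- move=> _.
  have AP0 : submatrix A T Rec *m submatrix P Rec Rec
               + submatrix A T T *m submatrix P T Rec = 0.
    apply/matrixP => k l; rewrite !mxE; apply: etrans (AP (enum_val k) (enum_val l)).
    by congr (_ + _); rewrite [RHS]big_enum_val; apply: eq_bigr => m _; rewrite !mxE.
  split=> //.
    apply/matrixP => k l; rewrite !mxE.
    by apply: final_limit_transient_col => //; exact: enum_valP.
  rewrite -mulmxA mulNmx.
  move/eqP: AP0; rewrite addrC addr_eq0 => /eqP AP0.
  by rewrite -(mulKmx unitT (submatrix P T Rec)) AP0 mulmxN.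
- move=> _ f k.
  (* W has the rows of P with index in T, and g J adds up the columns of A_{T,J};
     the rows of AP = 0 with index in T read A_T W + sum_J g_J p_J = 0. *)
  pose W : 'M[R]_(#|T|, n.+1) := \matrix_(l, j) P (enum_val l) j.
  pose g (J : {set 'I_n.+1}) := \sum_(j in J) \col_(l < #|T|) A (enum_val l) j.
  have AW : submatrix A T T *m W = - \sum_(J in C) g J *m stationary_row A J.
    apply/eqP; rewrite -addr_eq0 addrC; apply/eqP/matrixP => l j.
    rewrite !mxE; apply: etrans (AP (enum_val l) j); congr (_ + _); last first.
      by rewrite [RHS]big_enum_val; apply: eq_bigr => m _; rewrite !mxE.
    rewrite summxE /Rec -cover_recurrence_classes.
    rewrite big_trivIset ?recurrence_classes_trivIset//=.
    apply: eq_bigr => J JC; rewrite mxE big_ord1 /g summxE mulr_suml.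
    apply: eq_bigr => r rJ; rewrite !mxE -(final_limit_row_recurrent hA JC rJ).
    by rewrite mxE.
  have -> : row (enum_val k) P = row k W by apply/rowP => j; rewrite !mxE.
  rewrite -(mulKmx unitT W) AW mulmxN -mulNmx mulmx_sumr linear_sum/=.
  apply: eq_bigr => J _; rewrite mulmxA -/(f J).
  by apply/rowP => j; rewrite mxE [LHS]mxE big_ord1 [RHS]mxE.
Qed.
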